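(* Let $\alpha,\delta\in(0,1)$, $\epsilon>0$, and let $K\ge1$ be an integer. Let $s^1,\dots,s^K$ be real-valued score functions of the input. Let $\mathcal{T}_\mathrm{cal}=\{X_1,\dots,X_{n_\mathrm{cal}}\}$ be a calibration set of inputs drawn i.i.d. from the in-distribution input law $\mathrm{P}_X$, and let $X_\mathrm{test}$ be a new input. Write $T^i_j=s^i(X_j)$, $T^i_\mathrm{test}=s^i(X_\mathrm{test})$ and define conformal p-values $$\hat Q^i=\frac{1+|\{j\in\mathcal{T}_\mathrm{cal}: T^i_j\ge T^i_\mathrm{test}\}|}{1+n_\mathrm{cal}},\qquad i=1,\dots,K.$$ Let $m=\left|\left\{i:\hat Q^i\le\frac{\alpha}{(1+\epsilon)K}\right\}\right|$ and declare $X_\mathrm{test}$ to be OOD if $m\ge1$. Let $a=\lfloor (n_\mathrm{cal}+1)\frac{\alpha}{(1+\epsilon)K}\rfloor$, $b=(n_\mathrm{cal}+1)-a$, $\mu=\frac{a}{a+b}$, and suppose $n_\mathrm{cal}$ satisfies $I_{(1+\epsilon)\mu}(a,b)\ge1-\frac{\delta}{K}$, where $I_x(a,b)$ is the CDF at $x$ of a $\mathrm{Beta}(a,b)$ distribution. Let $\mathrm{H}_0$ denote the hypothesis that $X_\mathrm{test}\sim\mathrm{P}_X$ independently of $\mathcal{T}_\mathrm{cal}$. Then, with probability at least $1-\delta$ over the draw of $\mathcal{T}_\mathrm{cal}$, $$\mathrm{P}_{\mathrm{H}_0}(\text{declare OOD}\mid\mathcal{T}_\mathrm{cal})\le\alp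ha.$$
   Context: Each score $s^i(X)$ with $X\sim\mathrm{P}_X$ is assumed to have a continuous distribution; no assumption is made on the dependence among the scores. $\mathrm{P}_{\mathrm{H}_0}(\cdot\mid\mathcal{T}_\mathrm{cal})$ is the probability over $X_\mathrm{test}\sim\mathrm{P}_X$ with the calibration set held fixed. The condition on $n_\mathrm{cal}$ presupposes $a\ge1$ so that the Beta distribution is defined. *)

(* Defs.v *)
From HB Require Import structures.
From mathcomp Require Import all_boot all_order all_algebra.
From mathcomp Require Import all_classical all_reals all_analysis.
From mathcomp Require Import beta_distribution.
Set Implicit Arguments. Unset Strict Implicit. Unset Printing Implicit Defensive.
Import Order.TTheory GRing.Theory Num.Theory.
Local Open Scope classical_set_scope.
Local Open Scope ring_scope.

(* Mutual independence of the random variables X 0, ..., X (n-1) : Omega -> T: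
   the product rule for every family of measurable sets (taking some B j = setT
   gives the product rule for all subfamilies). *)
Definition mutually_independent {R : realType} {dO dT : measure_display}
  {Omega : measurableType dO} {T : measurableType dT}
  (P : probability Omega R) (n : nat) (X : 'I_n -> Omega -> T) : Prop :=
  forall B : 'I_n -> set T, (forall j, measurable (B j)) ->
    P (\bigcap_(j in [set: 'I_n]) (X j @^-1` B j)) =
    (\prod_(j < n) P (X j @^-1` B j))%E.

Definition has_law {R : realType} {dO dT : measure_display}
  {Omega : measurableType dO} {T : measurableType dT}
  (P : probability Omega R) (Y : Omega -> T) (PX : probability T R) : Prop :=
  forall B : set T, measurable B -> P (Y @^-1` B) = PX B.

Definition conformal_pvalue {R : realType} {T : Type} (n : nat)
  (si : T -> R) (xs : 'I_n -> T) (x : T) : R :=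
  (1 + #|[pred j : 'I_n | si x <= si (xs j)]|)%:R / (1 + n)%:R.

Definition n_reject {R : realType} {T : Type} (K n : nat) (alpha eps : R)
  (s : 'I_K -> T -> R) (xs : 'I_n -> T) (x : T) : nat :=
  #|[pred i : 'I_K | conformal_pvalue (s i) xs x <= alpha / ((1 + eps) * K%:R)]|.

Definition declare_OOD {R : realType} {T : Type} (K n : nat) (alpha eps : R)
  (s : 'I_K -> T -> R) (xs : 'I_n -> T) (x : T) : bool :=
  (1 <= n_reject alpha eps s xs x)%N.

Definition a_param {R : realType} (K n : nat) (alpha eps : R) : nat :=
  Num.truncn ((n + 1)%:R * (alpha / ((1 + eps) * K%:R))).

Definition beta_cdf {R : realType} (a b : nat) (x : R) : \bar R :=
  beta_prob a b `]-oo, x].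

(* Main.v *)
(* For each score pick t with PX (s > t) = x, where x = (1 + eps) mu. The number of
   calibration scores above t is Binomial(n, x), so by the duality between binomial
   tails and the incomplete beta function it is at least a with probability
   I_x(a, n + 1 - a). On that event a rejected input has fewer than a calibration
   scores at or above its own, hence a score above t, which has PX-probability x.
   Union bounds over the K scores give total failure probability at most delta and
   total rejection probability at most K x <= alpha. *)

Require Import Defs.
From HB Require Import structures.
From mathcomp Require Import all_boot all_order all_algebra.
From mathcomp Require Import all_classical all_reals all_analysis.
From mathcomp Require Import beta_distribution.
Import Order.TTheory GRing.Theory Num.Theory.
Import numFieldNormedType.Exports.
Local Open Scope classical_set_scope.
Local Open Scope ring_scope.

Set Implicit Arguments.
Unset Strict Implicit.

(** * Bernstein polynomials and the incomplete beta function *)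

Definition binomial_poly (R : realType) (n k : nat) : {poly R} :=
  'X^k * (1 - 'X) ^+ (n - k) *+ 'C(n, k).

Lemma horner_binomial_poly (R : realType) (n k : nat) (x : R) :
  (binomial_poly R n k).[x] = x ^+ k * (1 - x) ^+ (n - k) *+ 'C(n, k).
Proof.
by rewrite /binomial_poly hornerMn hornerM hornerXn horner_exp hornerD hornerN
  hornerX hornerC.
Qed.

(** Product rule; [mul_bin_diag] and [mul_bin_down] turn both exponents into the common factor
    [m.+1]. The difference form is what lets a sum of these derivatives telescope. *)
Lemma deriv_binomial_poly (R : realType) (m k : nat) : (k <= m)%N ->
  (binomial_poly R m.+1 k.+1)^`() =
  (binomial_poly R m k - binomial_poly R m k.+1) *+ m.+1.
Proof.
move=> km; rewrite /binomial_poly derivMn derivM derivXn subSS.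
have -> : ((1 - 'X : {poly R}) ^+ (m - k))^`() =
    - ((1 - 'X) ^+ (m - k.+1)) *+ (m - k).
  by rewrite deriv_exp derivB derivX derivC sub0r mulN1r subnS !mulNrn.
rewrite mulrnDl mulrnBl -!mulrnA; congr (_ + _).
  by rewrite mulrnAl -mulrnA -mul_bin_diag mulnC.
rewrite mulNrn mulrN mulrnAr mulNrn -!mulrnA; congr (- (_ *+ _)).
by rewrite -(subSS k m) -mul_bin_down mulnC.
Qed.

(** Supplies the normalising constant that makes the Beta density on [0, 1] equal to
    [binomial_poly R m k *+ m.+1]. *)
Lemma beta_fun_inv_binomial (R : realType) (m k : nat) : (k <= m)%N ->
  (beta_fun k.+1 (m - k).+1 : R)^-1 = ('C(m, k) * m.+1)%:R.
Proof.
move=> km; rewrite beta_fun_fact subnKC// invf_div factS -(bin_fact km).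
rewrite mulnA natrM mulfK; first by rewrite mulnC.
by rewrite pnatr_eq0 muln_eq0 negb_or -!lt0n !fact_gt0.
Qed.

(** As functions of [x], both sides vanish at 0 and have the Beta density as derivative, so the
    fundamental theorem of calculus on [0, x] identifies them. The right side is the upper tail,
    from [k.+1] on, of a Binomial([m.+1], [x]) law. *)
Lemma beta_cdf_binomial_poly (R : realType) (m k : nat) (x : R) :
  (k <= m)%N -> 0 < x <= 1 ->
  beta_cdf k.+1 (m - k).+1 x =
  (\sum_(k <= l < m.+1) (binomial_poly R m.+1 l.+1).[x])%:E.
Proof.
move=> km /andP[x0 x1].
pose p : {poly R} := \sum_(k <= l < m.+1) binomial_poly R m.+1 l.+1.
(* The derivative telescopes: only the density term survives. *)
have dp : p^`() = binomial_poly R m k *+ m.+1.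
  rewrite [LHS]linear_sum.
  rewrite (telescope_sumr_eq (fun l => - (binomial_poly R m l *+ m.+1))).
  (* The upper boundary term has coefficient C(m, m+1) = 0. *)
  - rewrite {1}/binomial_poly bin_small// mulr0n mul0rn oppr0 sub0r.
    by rewrite opprK.
  - exact: leq_trans km _.
  - move=> l /andP[_ lm]; rewrite [LHS]deriv_binomial_poly// mulrnBl opprK.
    by rewrite addrC.
have p0 : p.[0] = 0.
  rewrite horner_sum big1// => l _.
  by rewrite horner_binomial_poly expr0n/= mul0r mul0rn.
rewrite -horner_sum -/p /beta_cdf -integral_beta_pdf//.
rewrite integral_mkcond -[p.[x]]subr0 -p0.
rewrite EFinB -(@continuous_FTC2 _ (horner p^`()))//; last 3 first.
- by apply: continuous_in_subspaceT => y _; exact: continuous_horner.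
- split; first by move=> y _; exact: derivable_horner.
  + exact/cvg_at_right_filter/continuous_horner.
  + exact/cvg_at_left_filter/continuous_horner.
- by move=> y _; rewrite derivE.
(* Both integrands are now extended by zero to the whole line. The Beta density vanishes off [0, 1]
   and [x <= 1], so they agree pointwise. *)
rewrite [RHS]integral_mkcond; apply: eq_integral => y _.
rewrite !patchE /beta_pdf.
have [ynx|ynx] := boolP (y \in `]-oo, x]%classic); last first.
  rewrite ifF//; apply/negbTE; apply: contra ynx.
  by rewrite !inE/= !in_itv/= => /andP[].
have -> : (y \in `[0, x]%classic) = (0 <= y).
  by move: ynx; rewrite !mem_setE !in_itv/= => ->; rewrite andbT.
move: ynx; rewrite mem_setE in_itv/= => yx.
rewrite patchE mem_setE in_itv/= (le_trans yx x1) andbT.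
case: ifPn => y0; last by rewrite mul0r.
rewrite beta_fun_inv_binomial// dp hornerMn horner_binomial_poly /XMonemX.
by rewrite -mulrnA mulr_natr.
Qed.

(** * Exact upper quantiles of an atomless law *)

Lemma ccdf_threshold (d : measure_display) (T : measurableType d) (R : realType)
    (P : probability T R) (X : {RV P >-> R}) (x : R) :
  (forall t, P (X @^-1` [set t]) = 0%E) -> 0 < x < 1 ->
  exists t, ccdf X t = x%:E.
Proof.
move=> X0 /andP[x0 x1]; pose S := [set r | (ccdf X r <= x%:E)%E].
have S0 : S !=set0.
  have [r rx] : exists r, (ccdf X r < x%:E)%E.
    apply: (@filter_ex _ (+oo%R : set_system R)).
    have /(_ [set e | (e < x%:E)%E]) := cvg_ccdfy0 X.
    by apply; apply: open_ereal_lt'; rewrite lte_fin.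
  by exists r; exact: ltW.
have Slb : has_lbound S.
  have [r rx] : exists r, (x%:E < ccdf X r)%E.
    apply: (@filter_ex _ (-oo%R : set_system R)).
    have /(_ [set e | (x%:E < e)%E]) := cvg_ccdfNy1 X.
    by apply; apply: open_ereal_gt'; rewrite lte_fin.
  exists r => s; rewrite /S/= => sx.
  rewrite leNgt; apply/negP => sr.
  have := lt_le_trans rx (@ccdf_nonincreasing _ _ _ P X _ _ (ltW sr)).
  by rewrite ltNge sx.
(* The upper bound is right-continuity: any point right of [inf S] lies above an element of [S]. The
   lower bound needs left-continuity, which comes from the absence of atoms. *)
exists (inf S); apply/eqP; rewrite eq_le; apply/andP; split.
  apply: (@cvge_le _ _ _ _ _ _ _ _ (@ccdf_right_continuous _ _ _ P X (inf S))).
  near=> s.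
  have s_inf : 0 < s - inf S by rewrite subr_gt0; near: s; exact: nbhs_right_gt.
  have [e Se] := inf_adherent s_inf (conj S0 Slb).
  rewrite addrC subrK => es; apply: le_trans Se.
  exact/ccdf_nonincreasing/ltW.
(* These rays start left of [inf S], so each has mass at least [x]; they decrease to the closed ray
   at [inf S], whose mass equals that of the open ray. *)
pose F k : set R := `]inf S - k.+1%:R^-1, +oo[%classic.
have FE : \bigcap_k F k = `]inf S, +oo[ `|` [set inf S].
  by rewrite -itvcyEbigcap setUC setU1itv.
have mF k : measurable (F k) by exact: measurable_itv.
have := @nonincreasing_cvg_mu _ _ _ (distribution P X) F.
rewrite FE => /(_ _ mF)/= cF.
have -> : ccdf X (inf S) = distribution P X (`]inf S, +oo[ `|` [set inf S]).
  rewrite measureU//=; last first.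
    apply/seteqP; split => // y [/=]; rewrite in_itv/= andbT => /[swap] ->.
    by rewrite ltxx.
  by rewrite [X in (_ + X)%E]X0 adde0.
apply: (@cvge_ge _ _ _ _ _ _ _ _ (cF _ _ _)).
- apply: nearW => k; rewrite leNgt; apply/negP => kx.
  have : S (inf S - k.+1%:R^-1) by exact: ltW.
  move=> /(ge_inf Slb); apply/negP; rewrite -ltNge.
  by rewrite ltrBlDr ltrDl invr_gt0.
- by rewrite (le_lt_trans (probability_le1 _ _)) ?ltry.
- exact: measurableU.
- move=> m n mn; apply/subsetPset => y; rewrite /F /= !in_itv/= !andbT.
  apply: le_lt_trans; rewrite lerD2l lerN2 lef_pV2 ?posrE//.
  by rewrite ler_nat.
Unshelve. all: by end_near. Qed.

(** * Counting events for finite families of sets *)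

Section finite_families.
Context (d : measure_display) (T : measurableType d) (I : finType).
Variable F : I -> set T.

(** The atoms of the Boolean algebra generated by [F]. They partition the space, so an event
    depending only on which [F i] contain [w] is a finite disjoint union of them. *)
Definition membership_atom (A : {set I}) : set T :=
  \bigcap_(i in [set: I]) (if i \in A then F i else ~` F i).

Lemma membership_atomP (A : {set I}) (w : T) :
  membership_atom A w <-> A = [set i | w \in F i]%SET.
Proof.
split=> [Aw|->].
  apply/setP => i; rewrite inE; have := Aw i Logic.I.
  by case: ifPn => _ /= wF; apply/esym; [exact/mem_set|exact/memNset].
by move=> i _; rewrite inE; case: ifPn => /=; rewrite ?inE// => /negP; rewrite inE.
Qed.

Lemma membership_bigcup (p : pred {set I}) :
  [set w | p [set i | w \in F i]%SET] = \bigcup_(A in [set` p]) membership_atom A.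
Proof.
apply/seteqP; split=> [w /= pw|w [A /= pA /membership_atomP <-//]].
by exists [set i | w \in F i]%SET => //; exact/membership_atomP.
Qed.

Hypothesis mF : forall i, measurable (F i).

Lemma measurable_membership_atom (A : {set I}) : measurable (membership_atom A).
Proof.
apply: fin_bigcap_measurable => // i _; case: ifPn => // _; exact: measurableC.
Qed.

Lemma measurable_membership (p : pred {set I}) :
  measurable [set w | p [set i | w \in F i]%SET].
Proof.
rewrite membership_bigcup; apply: fin_bigcup_measurable => // A _.
exact: measurable_membership_atom.
Qed.

Lemma measure_membership (R : realType) (mu : {measure set T -> \bar R})
    (p : pred {set I}) :
  mu [set w | p [set i | w \in F i]%SET] =
  (\sum_(A : {set I} | p A) mu (membership_atom A))%E.
Proof.
rewrite membership_bigcup measure_fin_bigcup//.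
- have -> : [set` p] = [set` enum p].
    by apply/seteqP; split=> A /=; rewrite mem_enum.
  by rewrite -(fsbig_seq _ _ (enum_uniq _)) big_enum.
- by move=> A B _ _ [w [/membership_atomP -> /membership_atomP ->]].
- by move=> A _; exact: measurable_membership_atom.
Qed.

End finite_families.

(** Independence gives each atom a probability depending only on #|A|; grouping the sets [A] by
    cardinality produces the binomial coefficients. *)
Lemma binomial_tail (R : realType) (dO dT : measure_display)
    (Omega : measurableType dO) (T : measurableType dT)
    (P : probability Omega R) (PX : probability T R) (n : nat)
    (X : 'I_n -> Omega -> T) (B : set T) (x : R) (a : nat) :
  (forall j, measurable_fun setT (X j)) -> (forall j, has_law P (X j) PX) ->
  mutually_independent P X -> measurable B -> PX B = x%:E ->
  P [set w | (a <= #|[set j | w \in X j @^-1` B]%SET|)%N] =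
  (\sum_(k < n.+1 | (a <= k)%N) x ^+ k * (1 - x) ^+ (n - k) *+ 'C(n, k))%:E.
Proof.
move=> mX lawX indX mB PB.
have mXB j C : measurable C -> measurable (X j @^-1` C).
  by move=> mC; rewrite -[X in measurable X]setTI; exact: mX.
have atom (A : {set 'I_n}) :
    P (membership_atom (fun j => X j @^-1` B) A) =
    (x ^+ #|A| * (1 - x) ^+ (n - #|A|))%:E.
  (* Independence is stated for arbitrary measurable sets, so complements may be used in the product
     rule directly. *)
  pose C j := if j \in A then B else ~` B.
  have mC j : measurable (C j) by rewrite /C; case: ifP => // _; exact: measurableC.
  have -> : membership_atom (fun j => X j @^-1` B) A =
      \bigcap_(j in [set: 'I_n]) (X j @^-1` C j).
    by apply: eq_bigcapr => j _; rewrite /C; case: ifP.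
  rewrite indX// (eq_bigr (fun j => (if j \in A then x else 1 - x)%:E)).
    rewrite prodEFin; congr (_%:E).
    rewrite (bigID [in A])/= (eq_bigr (fun=> x)) => [|j ->//].
    rewrite [X in _ * X](eq_bigr (fun=> 1 - x)) => [|j /negbTE->//].
    rewrite !prodr_const; congr (_ * _ ^+ _).
    by rewrite -[X in (X - _)%N](card_ord n) -(cardC A) addKn.
  move=> j _; rewrite lawX// /C; case: ifP => _ //.
  by rewrite probability_setC// PB EFinB.
transitivity (\sum_(A : {set 'I_n} | (a <= #|A|)%N)
    P (membership_atom (fun j => X j @^-1` B) A))%E.
  exact: (measure_membership (fun j => mXB j _ mB) P (fun A => a <= #|A|)%N).
rewrite (eq_bigr _ (fun A _ => atom A)) sumEFin; congr (_%:E).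
rewrite (partition_big (fun A : {set 'I_n} => inord #|A| : 'I_n.+1)
  (fun k : 'I_n.+1 => a <= k)%N) => [|A aA]; last first.
  by rewrite inordK// ltnS -[leqRHS]card_ord max_card.
apply: eq_bigr => k ak.
rewrite (eq_bigl (fun A : {set 'I_n} =>
  A \in [set A : {set 'I_n} | #|A| == k]%SET)).
  rewrite (eq_bigr (fun=> x ^+ k * (1 - x) ^+ (n - k))) => [|A]; last first.
    by rewrite inE => /eqP ->.
  by rewrite sumr_const card_draws card_ord.
move=> A; rewrite inE -val_eqE/= inordK; last first.
  by rewrite ltnS -[leqRHS]card_ord max_card.
by apply: andb_idl => /eqP ->.
Qed.

Lemma finite_union_bound (d : measure_display) (T : measurableType d) (R : realType)
    (mu : {measure set T -> \bar R}) (I : finType) (F : I -> set T) (c : R) :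
  (forall i, measurable (F i)) -> (forall i, (mu (F i) <= c%:E)%E) ->
  (mu (\bigcup_(i in [set: I]) F i) <= (#|I|%:R * c)%:E)%E.
Proof.
move=> mF Fc.
have -> : [set: I] = [set` enum I].
  by apply/seteqP; split=> i //= _; rewrite mem_enum.
rewrite bigcup_seq cardE; elim: (enum I) => [|i s ih].
  by rewrite big_nil measure0 mul0r.
rewrite big_cons /= -[(size s).+1]addn1 natrD mulrDl mul1r addrC EFinD.
apply: le_trans (leeD (Fc i) ih); apply: measureU2 => //.
exact: bigsetU_measurable.
Qed.

(** With [c] the calibration scores, this set is the rejection region of a single score. *)
Lemma measurable_card_ge (d : measure_display) (T : measurableType d)
    (R : realType) (f : T -> R) (n : nat) (c : 'I_n -> R) (a : nat) :
  measurable_fun setT f ->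
  measurable [set y | (#|[pred j | (f y <= c j)%R]| < a)%N].
Proof.
move=> mf; pose F j := f @^-1` `]-oo, c j]%classic.
have mF j : measurable (F j).
  by rewrite -[X in measurable X]setTI; exact: mf.
have cardF y : #|[set j | y \in F j]%SET| = #|[pred j | f y <= c j]|.
  apply: eq_card => j; rewrite !inE /=.
  apply/idP/idP => [/set_mem|yj]; last apply/mem_set; by rewrite /F/= in_itv.
have := measurable_membership mF (fun A => #|A| < a)%N.
by congr (measurable _); apply/seteqP; split=> y /=; rewrite cardF.
Qed.

(** * From one score to all scores *)

Lemma score_event (R : realType) (n : nat)
  (dO dT : measure_display) (Omega : measurableType dO) (T : measurableType dT)
  (P : probability Omega R) (PX : probability T R)
  (f : T -> R) (X : 'I_n -> Omega -> T) (a : nat) (x : R) :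
  measurable_fun setT f -> (forall t : R, PX (f @^-1` [set t]) = 0%E) ->
  (forall j, measurable_fun setT (X j)) -> (forall j, has_law P (X j) PX) ->
  mutually_independent P X ->
  (0 < a <= n)%N -> 0 < x < 1 ->
  exists E : set Omega, [/\ measurable E,
    P E = beta_cdf a (n + 1 - a) x &
    forall w, E w ->
      (PX [set y | (#|[pred j | (f y <= f (X j w))%R]| < a)%N] <= x%:E)%E].
Proof.
move=> mf f0 mX lawX indX /andP[a0 an] /[dup] x01 /andP[x0 x1].
have [t ft] := @ccdf_threshold _ _ _ PX (mfun_Sub (mem_set mf)) x f0 x01.
pose B := f @^-1` `]t, +oo[%classic.
have mfB (C : set R) : measurable C -> measurable (f @^-1` C).
  by move=> mC; rewrite -[X in measurable X]setTI; exact: (mf measurableT).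
have mB : measurable B by exact: mfB.
have PB : PX B = x%:E by [].
have mXB j : measurable (X j @^-1` B).
  by rewrite -[X in measurable X]setTI; exact: mX.
exists [set w | (a <= #|[set j | w \in X j @^-1` B]%SET|)%N]; split.
- exact: (measurable_membership mXB (fun A => a <= #|A|)%N).
- rewrite (binomial_tail _ mX lawX indX mB PB).
  (* Since 0 < a <= n, both are successors, which matches the shifted indices of
     [beta_cdf_binomial_poly]. *)
  case: n an X mX lawX indX mXB => [|m]; first by rewrite leqNgt a0.
  case: a a0 => // k _; rewrite ltnS => km _ _ _ _ _.
  rewrite addn1 subSS subSn// beta_cdf_binomial_poly ?x0 ?ltW//; congr (_%:E).
  transitivity (\sum_(k.+1 <= l < m.+2) (binomial_poly R m.+1 l).[x]).
    rewrite big_geq_mkord; apply: eq_big => // l _.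
    by rewrite horner_binomial_poly.
  by rewrite big_add1.
- move=> w /= aw; rewrite -PB; apply: le_measure; rewrite ?inE//.
    exact: measurable_card_ge.
  (* If [f y <= t], each calibration score above [t] is at least [f y], making the count at least
     [a]. *)
  move=> y /= ya; rewrite /B/= in_itv/= andbT ltNge; apply/negP => yt.
  move: aw; apply/negP; rewrite -ltnNge; apply: leq_ltn_trans ya.
  apply: subset_leq_card; apply/fintype.subsetP => j.
  rewrite !inE/= /B/= in_itv/= andbT.
  by move=> /ltW; exact: le_trans.
Qed.

Unset Implicit Arguments.
Set Strict Implicit.

Theorem theorem2 (R : realType) (alpha delta eps : R) (K n : nat)
  (dO dT : measure_display) (Omega : measurableType dO) (T : measurableType dT)
  (P : probability Omega R) (PX : probability T R)
  (s : 'I_K -> T -> R) (X : 'I_n -> Omega -> T) :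
  0 < alpha < 1 -> 0 < delta < 1 -> 0 < eps -> (1 <= K)%N ->
  (forall i, measurable_fun setT (s i)) ->
  (forall i (t : R), PX (s i @^-1` [set t]) = 0%E) ->
  (forall j, measurable_fun setT (X j)) ->
  (forall j, has_law P (X j) PX) ->
  mutually_independent P X ->
  let a := a_param K n alpha eps in
  let b := ((n + 1) - a)%N in
  let mu : R := a%:R / (a + b)%:R in
  (1 <= a)%N ->
  (beta_cdf a b ((1 + eps) * mu) >= (1 - delta / K%:R)%:E)%E ->
  exists E : set Omega, [/\ measurable E,
    (P E >= (1 - delta)%:E)%E &
    forall w, E w ->
      (PX [set x | declare_OOD alpha eps s (fun j => X j w) x] <= alpha%:E)%E].
Proof.
move=> /andP[al0 al1] /andP[de0 de1] ep0 K0 ms s0 mX lawX indX a b mu a0 hb.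
have K0' : 0 < K%:R :> R by rewrite ltr0n.
have K1' : 1 <= K%:R :> R by rewrite ler1n.
have ep1 : 0 < 1 + eps by rewrite addr_gt0.
have n0 : 0 < (n + 1)%:R :> R by rewrite ltr0n addn1.
pose q := alpha / ((1 + eps) * K%:R).
have q0 : 0 < q by rewrite divr_gt0// mulr_gt0.
have q1 : q < 1.
  rewrite ltr_pdivrMr ?mulr_gt0// mul1r (lt_le_trans al1)//.
  by rewrite mulr_ege1// lerDl ltW.
have aq : a%:R <= (n + 1)%:R * q by rewrite truncn_le// mulr_ge0// ltW.
(* [q < 1] keeps [a] below [n + 1], so the truncated subtraction defining [b] is exact. *)
have an : (a <= n)%N.
  suff : (a < n + 1)%N by rewrite addn1 ltnS.
  by rewrite -(ltr_nat R); apply: le_lt_trans aq _; rewrite gtr_pMr.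
have abn : (a + b = n + 1)%N by rewrite subnKC// addn1 ltnW.
pose x := (1 + eps) * mu.
have x0 : 0 < x by rewrite mulr_gt0// divr_gt0 ?ltr0n// abn addn1.
(* Rounding down in [a] gives [mu <= q], and K (1 + eps) q = alpha. *)
have Kx : K%:R * x <= alpha.
  rewrite /x /mu abn !mulrA ler_pdivrMr// [K%:R * _]mulrC
    [leLHS]mulrC [leRHS]mulrC.
  by rewrite -ler_pdivlMr ?mulr_gt0// -mulrA.
have x1 : x < 1.
  by apply: le_lt_trans al1; apply: le_trans Kx; rewrite ler_peMl// ltW.
have aan : (0 < a <= n)%N by rewrite a0.
have x01 : 0 < x < 1 by rewrite x0.
have [E /all_and3[mE PE EP]] := choice (fun i =>
  score_event (ms i) (s0 i) mX lawX indX aan x01).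
have mE' : measurable (\bigcap_(i in [set: 'I_K]) E i).
  by apply: fin_bigcap_measurable => // i _; exact: mE.
exists (\bigcap_(i in [set: 'I_K]) E i); split => //.
  (* Passing to complements, each score fails with probability at most delta / K; no independence
     between scores enters. *)
  rewrite -[X in P X]setCK setC_bigcap probability_setC; last first.
    by rewrite -setC_bigcap; exact: measurableC.
  rewrite EFinB leeB//.
  have -> : delta = #|'I_K|%:R * (delta / K%:R).
    by rewrite card_ord mulrC divfK// gt_eqF.
  apply: finite_union_bound => i; first exact: measurableC.
  apply: (@le_trans _ _ (1 - P (E i))%E).
    by rewrite -(probability_setC P (mE i)).
  move: hb; rewrite -/x -[beta_cdf _ _ _](PE i).
  rewrite -[P (E i)]fineK ?fin_num_measure// -EFinB !lee_fin.
  by rewrite !lerBlDr addrC.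
move=> w Ew.
have -> : [set y | declare_OOD alpha eps s (fun j => X j w) y] =
    \bigcup_(i in [set: 'I_K])
      [set y | (#|[pred j | (s i y <= s i (X j w))%R]| < a)%N].
  (* With c the count, the p-value is at most [q] iff c + 1 <= (n + 1) q, iff c + 1 <= a by the
     floor. The 1 in the numerator makes the inequality strict. *)
  have reject i y : (conformal_pvalue (s i) (fun j => X j w) y <= q) =
      (#|[pred j | (s i y <= s i (X j w))%R]| < a)%N.
    rewrite /conformal_pvalue ler_pdivrMr; last by rewrite ltr0n.
    rewrite [(1 + n)%N]addnC [q * _]mulrC add1n /a /a_param.
    by rewrite truncn_ge_nat// mulr_ge0 ?ltW.
  apply/seteqP; split => y; rewrite /= /declare_OOD /n_reject.
    move=> /card_gt0P[i]; rewrite inE/= reject => ?.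
    by exists i.
  move=> [i _ /= ia]; apply/card_gt0P; exists i.
  by rewrite inE/= reject.
apply: (@le_trans _ _ (#|'I_K|%:R * x)%:E); last by rewrite card_ord lee_fin.
apply: finite_union_bound => i; last exact: EP (Ew i Logic.I).
exact: measurable_card_ge.
Qed.
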